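(* Let $M$ be a loopless matroid of rank $r$ on $E$, and let $S_1,\dots,S_{r-1}$ be nonempty subsets of $E$ (with repeats allowed). Then $$\deg_M(\beta_{S_1}\cdots\beta_{S_{r-1}})>0\iff\deg_M(\alpha_{S_1}\cdots\alpha_{S_{r-1}})>0.$$ In particular, $\deg_M(\beta_{S_1}\cdots\beta_{S_{r-1}})>0$ if and only if $(S_1,\dots,S_{r-1})$ satisfies the dragon-Hall–Rado condition with respect to $M$, i.e. $\operatorname{rk}_M\bigl(\bigcup_{i\in I}S_i\bigr)\ge1+|I|$ for all $\varnothing\subsetneq I\subseteq\{1,\dots,r-1\}$.
   Context: ''Proper flat'' means a flat $F$ with $\varnothing\ne F\ne E$. $A^*(M)=\mathbb{Z}[x_F:F\text{ proper flat of }M]/(I+J)$, with $I$ generated by $x_Fx_G$ for incomparable $F,G$ and $J$ by $\sum_{F\ni i}x_F-\sum_{F\ni j}x_F$ ($i,j\in E$). For $M$ of rank $r$, $\deg_M:A^{r-1}(M)\to\mathbb{Z}$ is the isomorphism sending $x_{F_1}\cdots x_{F_{r-1}}$ to $1$ for every complete flag $F_1\subsetneq\cdots\subsetneq F_{r-1}$ of proper flats. $\alpha=\sum_{F\ni i}x_F$ and $\beta=\sum_{F\not\ni i}x_F$ (independent of $i\in E$). For $\varnothing\ne S\subseteq E$, $\alpha_S=\alpha-\sum_{\text{proper flats }F\supseteq S}x_F$ and $\beta_S=\beta-\sum_{\text{proper flats }F\subseteq E\setminus S}x_F$. *)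

(* Defs.v *)
From HB Require Import structures.
From mathcomp Require Import all_boot all_order all_algebra.
From mathcomp Require Import ring_quotient mpoly.
From mathcomp Require Import boolp.

Set Implicit Arguments.
Unset Strict Implicit.
Unset Printing Implicit Defensive.

Import GRing.Theory.
Local Open Scope ring_scope.
Local Open Scope quotient_scope.

(* The ground set is the whole finite type E; the axioms are those of a rank
   function. *)
Record matroid (E : finType) := Matroid {
  rk : {set E} -> nat;
  rk_card : forall A, (rk A <= #|A|)%N;
  rk_mono : forall A B : {set E}, A \subset B -> (rk A <= rk B)%N;
  rk_submod : forall A B, (rk (A :|: B) + rk (A :&: B) <= rk A + rk B)%N
}.

Section Matroid.
Variables (E : finType) (M : matroid E).

Definition rank : nat := rk M [set: E].

Definition loopless : Prop := forall e : E, rk M [set e] = 1%N.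

Definition flat (F : {set E}) : bool :=
  [forall e, (e \notin F) ==> (rk M F < rk M (e |: F))%N].

Definition proper_flat (F : {set E}) : bool :=
  [&& flat F, F != set0 & F != [set: E]].

(* The variables x_F of Z[x_F : F proper flat] are numbered by enum_rank. *)
Local Notation pflat := {F : {set E} | proper_flat F}.
Local Notation flat_poly := {mpoly int[#|{: pflat}|]}.

Definition var (F : pflat) : flat_poly := 'X_(enum_rank F).

Inductive chow_rel : flat_poly -> Prop :=
| Rel_incomparable (F G : pflat) :
    ~~ (val F \subset val G) -> ~~ (val G \subset val F) -> chow_rel (var F * var G)
| Rel_linear (i j : E) :
    chow_rel (\sum_(F : pflat | i \in val F) var F
              - \sum_(F : pflat | j \in val F) var F).

Definition chow_ideal : {pred flat_poly} := fun p =>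
  `[< exists s : seq (flat_poly * flat_poly),
        (forall cg, cg \in s -> chow_rel cg.2)
        /\ p = \sum_(cg <- s) cg.1 * cg.2 >].

Lemma chow_ideal_closed : idealr_closed chow_ideal.
Proof.
split.
- by apply/asboolP; exists [::]; rewrite big_nil.
- apply/asboolP => -[s [hs h1]].
  have ev0 g : chow_rel g -> g.@[fun _ => 0] = 0 :> int.
    case=> [F G _ _|i j]; first by rewrite mevalM !mevalXU mulr0.
    rewrite mevalB !(raddf_sum (meval _)) !big1 ?subr0 // => F _; apply: mevalXU.
  have /eqP := congr1 (meval (fun _ => 0 : int)) h1.
  rewrite meval1 (raddf_sum (meval _)) /= big_seq big1 ?oner_eq0 // => cg /hs /ev0 h.
  by rewrite mevalM h mulr0.
- move=> a u v /asboolP[s [hs ->]] /asboolP[t [ht ->]]; apply/asboolP.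
  exists ([seq (a * cg.1, cg.2) | cg <- s] ++ t); split=> [cg|].
    by rewrite mem_cat => /orP[/mapP[d /hs ? ->]|/ht].
  rewrite big_cat big_map /= mulr_sumr; congr (_ + _).
  by apply: eq_bigr => cg _; rewrite mulrA.
Qed.

HB.instance Definition _ := isIdealr.Build flat_poly chow_ideal chow_ideal_closed.

Local Notation chow := {ideal_quot chow_ideal}.

Definition chow_pi (p : flat_poly) : chow := \pi_{ideal_quot chow_ideal} p.

Definition x_ (F : pflat) : chow := chow_pi (var F).

Definition chow_gr (k : nat) (a : chow) : Prop :=
  exists p : flat_poly, p \is k.-homog /\ a = chow_pi p.

(* deg restricts to a group isomorphism A^(r-1)(M) -> Z that maps every complete
   flag monomial to 1; its values outside A^(r-1)(M) are irrelevant. *)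
Record degree_map (deg : chow -> int) : Prop := DegreeMap {
  degD : forall a b, chow_gr rank.-1 a -> chow_gr rank.-1 b ->
    deg (a + b) = deg a + deg b;
  deg_inj : forall a b, chow_gr rank.-1 a -> chow_gr rank.-1 b ->
    deg a = deg b -> a = b;
  deg_surj : forall z : int, exists a, chow_gr rank.-1 a /\ deg a = z;
  deg_flag : forall F : 'I_rank.-1 -> pflat,
    (forall i j : 'I_rank.-1, (i < j)%N -> val (F i) \proper val (F j)) ->
    deg (\prod_(i < rank.-1) x_ (F i)) = 1
}.

(* The element of E is arbitrary (alphaE, betaE); if E is empty, there are no
   proper flats and all these sums are empty. *)
Definition alpha : chow :=
  if [pick i : E] is Some i then \sum_(F : pflat | i \in val F) x_ F else 0.

Definition beta : chow :=
  if [pick i : E] is Some i then \sum_(F : pflat | i \notin val F) x_ F else 0.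

Lemma chow_lin (i j : E) :
  \sum_(F : pflat | i \in val F) x_ F
  = \sum_(F : pflat | j \in val F) x_ F.
Proof.
rewrite /x_ /chow_pi -!(raddf_sum \pi_chow); apply/eqP.
rewrite -Quotient.idealrBE; apply/asboolP.
exists [:: (1, \sum_(F : pflat | i \in val F) var F
              - \sum_(F : pflat | j \in val F) var F)].
split=> [cg|]; last by rewrite big_seq1 mul1r.
by rewrite inE => /eqP ->; apply: Rel_linear.
Qed.

Lemma alphaE (i : E) : alpha = \sum_(F : pflat | i \in val F) x_ F.
Proof.
by rewrite /alpha; case: pickP => [j _|/(_ i)//]; apply: chow_lin.
Qed.

Lemma betaE (i : E) : beta = \sum_(F : pflat | i \notin val F) x_ F.
Proof.
rewrite /beta; case: pickP => [j _|/(_ i)//].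
apply: (addrI (\sum_(F : pflat | i \in val F) x_ F)).
rewrite {1}(chow_lin i j).
by rewrite -(bigID (fun F : pflat => j \in val F) xpredT)
           -(bigID (fun F : pflat => i \in val F) xpredT).
Qed.

Definition alpha_ (S : {set E}) : chow :=
  alpha - \sum_(F : pflat | S \subset val F) x_ F.

Definition beta_ (S : {set E}) : chow :=
  beta - \sum_(F : pflat | val F \subset ~: S) x_ F.

Definition dragon_Hall_Rado (n : nat) (S : 'I_n -> {set E}) : Prop :=
  forall I : {set 'I_n}, I != set0 ->
    (1 + #|I| <= rk M (\bigcup_(i in I) S i))%N.

End Matroid.

Arguments chow_ideal {E} M.

Notation chow M := {ideal_quot (chow_ideal M)}.

(* Main.v *)
Require Import Defs.
From mathcomp Require Import all_boot all_order all_algebra.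
From mathcomp Require Import ring_quotient mpoly boolp zify.
Local Open Scope ring_scope.

(** Both positivity statements are equivalent to the dragon-Hall-Rado condition,
    for a reason that treats [alpha_] and [beta_] in the same way.

    For a chain [C] of proper flats with product [x_C], and for [i] in [S],
    [alpha_ S] is the sum of the [x_F] with [i] in [F] and [S] not inside [F],
    and [beta_ S] is the sum of the [x_F] with [i] outside [F] and [F] meeting
    [S].  In both cases [i] can be adapted to [C] so that no [F] in the sum has
    the same trace on [S] as a member of [C]; in particular no square occurs.
    Hence [x_C] times such a class is a sum of monomials of longer chains
    ([cut_step]), and a product of [r-1] such classes is a sum of monomials of
    complete flags, each of degree [1].  The interface [cut_family] records what
    [alpha_] and [beta_] share, and the rest uses only this interface.

    Positive degree implies dragon-Hall-Rado ([dragon_of_deg_gt0]): a complete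
    flag in the expansion assigns to each [k] a flat [G k] that separates
    [S k], and for [I] nonempty and [T] the union of the [S k] over [I] the
    traces of these flats on [T] are distinct.  A chain of flats with distinct
    traces on [T] has distinct ranks of traces, and these ranks lie strictly
    between [0] and [rk T]; so [#|I| < rk T].

    Dragon-Hall-Rado implies positive degree ([deg_gt0_of_dragon]).  By
    submodularity the sets [S k] can be shrunk to pairs [{a k, b k}] that still
    satisfy the condition ([dragon_shrink]), and shrinking does not increase the
    degree, because it changes the class by a sum of variables
    ([deg_cut_mono]).  On pairs the two families agree: the class of [{a, b}] is
    the sum of the [x_F] that contain [a] and not [b].  For pairs, a flat [H]
    exists that separates exactly one of them and such that the pairs inside [H]
    and the pairs outside [H] satisfy the condition relative to the restriction
    to [H] and the contraction by [H] ([split_flat]).  Iterating in both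
    intervals orders the pairs so that the [k]-th flat found separates the
    [k]-th pair and no later one ([elimination_order]); multiplying in this
    order, the flag of these flats survives with positive coefficient
    ([deg_elimination_gt0]). *)

Set Implicit Arguments.
Unset Strict Implicit.
Unset Printing Implicit Defensive.

Import Order.TTheory GRing.Theory Num.Theory.

Local Open Scope quotient_scope.

(** * Rank and flats *)

Section FlatHull.
Variables (E : finType) (M : matroid E).
Implicit Types A B F T : {set E}.

Definition flat_hull A : {set E} := [set e | rk M (e |: A) == rk M A].

Lemma rk0 : rk M set0 = 0%N.
Proof. by have := rk_card M set0; rewrite cards0; case: (rk M set0). Qed.

(** Marginal ranks decrease: a set that adds nothing to [B] adds nothing to a
    larger set. *)
Lemma rk_addU A B X :
  rk M (B :|: X) = rk M B -> B \subset A -> rk M (A :|: X) = rk M A.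
Proof.
move=> eqB sBA; have := rk_submod M A (B :|: X).
have /(rk_mono M) : B \subset A :&: (B :|: X) by rewrite subsetI sBA subsetUl.
have /(rk_mono M) : A \subset A :|: X by apply: subsetUl.
have -> : A :|: (B :|: X) = A :|: X by rewrite setUA (setUidPl sBA).
by lia.
Qed.

Lemma rk_setU1 A e : (rk M (e |: A) <= (rk M A).+1)%N.
Proof.
have := rk_submod M [set e] A; have := rk_card M [set e]; rewrite cards1.
by lia.
Qed.

Lemma sub_flat_hull A : A \subset flat_hull A.
Proof. by apply/subsetP => e eA; rewrite inE (setUidPr _) // sub1set. Qed.

(** The hull absorbs its elements one at a time; the union with [B] makes the
    lemma usable for ranks in the contraction by the hull. *)
Lemma rk_flat_hullU A B : rk M (flat_hull A :|: B) = rk M (A :|: B).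
Proof.
suff cl s : all (mem (flat_hull A)) s -> rk M (A :|: [set:: s] :|: B) = rk M (A :|: B).
  rewrite -(cl (enum (flat_hull A))); last by apply/allP => e; rewrite mem_enum.
  by rewrite set_enum (setUidPr (sub_flat_hull A)).
elim: s => [|e s IHs] /=; first by rewrite set_nil setU0.
rewrite inE => /andP[/eqP eA /IHs <-].
have -> : A :|: [set:: e :: s] :|: B = (A :|: [set:: s] :|: B) :|: [set e].
  by apply/setP => x; rewrite !inE; do !case: (_ \in _); do ?case: (_ == _).
apply: (@rk_addU _ A); first by rewrite setUC.
by rewrite -setUA subsetUl.
Qed.

Lemma rk_flat_hull A : rk M (flat_hull A) = rk M A.
Proof. by have := rk_flat_hullU A set0; rewrite !setU0. Qed.

Lemma flat_hull_flat A : flat M (flat_hull A).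
Proof.
apply/forallP => e; apply/implyP; rewrite inE rk_flat_hull => neA.
have := rk_mono M (subsetUr [set e] A).
rewrite (setUC [set e] (flat_hull A)) rk_flat_hullU setUC in neA *.
by lia.
Qed.

Lemma flat_hull_sub A F : flat M F -> A \subset F -> flat_hull A \subset F.
Proof.
move=> /forallP fF sAF; apply/subsetP => e; rewrite inE => /eqP eA.
apply/negPn/negP => eF; have /implyP /(_ eF) := fF e.
by rewrite setUC (rk_addU _ sAF) ?ltnn // setUC.
Qed.

(** Traces of flats on [T] are flats of the restriction to [T]: if [e] were
    spanned by the trace of [F], it would be spanned by [F]. *)
Lemma flat_trace_lt F T e :
  flat M F -> e \in T -> e \notin F -> (rk M (F :&: T) < rk M (e |: (F :&: T)))%N.
Proof.
move=> /forallP /(_ e) /implyP fF eT eF; have := fF eF.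
have [/rk_addU h|] := eqVneq (rk M (F :&: T :|: [set e])) (rk M (F :&: T)).
  by rewrite setUC h ?ltnn // subsetIl.
rewrite setUC; have := rk_mono M (subsetUr [set e] (F :&: T)).
by lia.
Qed.

Lemma trace_rk_lt F G T :
  flat M F -> F :&: T \proper G :&: T -> (rk M (F :&: T) < rk M (G :&: T))%N.
Proof.
move=> fF /properP[sFG [e]]; rewrite !inE => /andP[eG eT].
rewrite eT andbT => eF; apply: leq_trans (flat_trace_lt fF eT eF) _.
by apply: rk_mono; rewrite subUset sFG sub1set !inE eG eT.
Qed.

Definition nested (F G : {set E}) : bool := (F \subset G) || (G \subset F).

Definition separates (F S : {set E}) : bool := (S :&: F != set0) && ~~ (S \subset F).

Lemma nested_refl (F : {set E}) : nested F F.
Proof. by rewrite /nested subxx. Qed.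

Lemma nestedC (F G : {set E}) : nested F G = nested G F.
Proof. by rewrite /nested orbC. Qed.

End FlatHull.

(** * Shrinking sets to pairs *)

Section Shrink.
Variables (E : finType) (M : matroid E).

(** If some [S k] has at least three elements, then of any two of its elements
    [s] and [s'] one can be deleted.  Otherwise there are violations [I] after
    deleting [s] and [J] after deleting [s'], both containing [k].  The two
    unions of sets cover the original union over [I :|: J], of rank at least
    [1 + #|I :|: J|], and their intersection has rank at least [#|I :&: J|]:
    for indices besides [k] this is the condition itself, and if [k] is the only
    common index it holds because a third element of [S k] is not a loop.
    Submodularity then bounds the sum of the two ranks below by
    [1 + #|I| + #|J|], a contradiction. *)
Lemma dragon_shrink n (S : 'I_n -> {set E}) :
  loopless M -> dragon_Hall_Rado M S ->
  exists S' : 'I_n -> {set E},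
    [/\ forall k, S' k \subset S k, forall k, #|S' k| = 2 & dragon_Hall_Rado M S'].
Proof.
move=> hM; have [m] := ubnP (\sum_k #|S k|)%N.
elim: m S => // m IHm S leSm hS.
have S_ge2 k : (2 <= #|S k|)%N.
  have k0 : [set k] != set0 by apply/set0Pn; exists k; rewrite inE.
  by have := hS _ k0; rewrite big_set1 cards1 => /leq_trans; apply; apply: rk_card.
have [/forallP S2|] := boolP [forall k, #|S k| == 2].
  by exists S; split=> // k; apply/eqP.
rewrite negb_forall => /existsP[k Sk2].
have Sk3 : (2 < #|S k|)%N by rewrite ltn_neqAle eq_sym Sk2 S_ge2.
pose del s j := if j == k then S j :\ s else S j.
have delS s j : del s j \subset S j by rewrite /del; case: ifP => // _; apply: subD1set.
have finish s : s \in S k -> dragon_Hall_Rado M (del s) ->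
    exists S' : 'I_n -> {set E},
    [/\ forall k, S' k \subset S k, forall k, #|S' k| = 2 & dragon_Hall_Rado M S'].
  move=> sk hs; have [|S' [sS' S'2 hS']] := IHm (del s) _ hs.
    move: leSm; rewrite ltnS; apply: leq_trans; rewrite (bigD1 k) // [X in (_ < X)%N](bigD1 k) //=.
    have -> : del s k = S k :\ s by rewrite /del eqxx.
    rewrite [X in (_ < X + _)%N](cardsD1 s) sk add1n addSn ltnS leq_add2l.
    by apply: leq_sum => j _; rewrite subset_leq_card.
  by exists S'; split=> // j; apply: subset_trans (sS' j) _.
have /card_gt1P[s [s' [sk s'k ss']]] := S_ge2 k.
pose bad s := [exists I : {set 'I_n}, (I != set0) && (rk M (\bigcup_(i in I) del s i) <= #|I|)%N].
have nbad t : ~~ bad t -> dragon_Hall_Rado M (del t).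
  move=> /existsPn nb I I0; by have := nb I; rewrite I0 andTb -ltnNge.
have [/existsP[I /andP[I0 leI]]|/nbad] := boolP (bad s); last exact: finish.
have [/existsP[J /andP[J0 leJ]]|/nbad] := boolP (bad s'); last exact: finish.
(* A violation must involve the set that has changed. *)
have kin t (K : {set 'I_n}) : K != set0 -> (rk M (\bigcup_(i in K) del t i) <= #|K|)%N -> k \in K.
  move=> K0 leK; apply/negPn/negP => kK; have := hS K K0.
  rewrite (eq_bigr (del t)) => [|i iK]; first by move=> /leq_trans/(_ leK); rewrite ltnn.
  by rewrite /del; case: eqP iK kK => // -> ->.
have kI := kin _ _ I0 leI; have kJ := kin _ _ J0 leJ.
have := rk_submod M (\bigcup_(i in I) del s i) (\bigcup_(i in J) del s' i).
have : (#|I :&: J| <= rk M ((\bigcup_(i in I) del s i) :&: (\bigcup_(i in J) del s' i)))%N.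
  have [IJk|IJk] := eqVneq ((I :&: J) :\ k) set0.
    rewrite (cardsD1 k) IJk cards0 addn0 inE kI kJ /=.
    have /card_gt0P[t] : (0 < #|S k :\ s :\ s'|)%N.
      have := cardsD1 s (S k); have := cardsD1 s' (S k :\ s).
      by rewrite sk !inE s'k eq_sym ss' /=; lia.
    rewrite !inE => /and3P[ts' ts tk]; rewrite -(hM t); apply: rk_mono.
    rewrite sub1set inE; apply/andP.
    by split; apply/bigcupP; exists k; rewrite // /del eqxx !inE ?ts ?ts'.
  have := hS _ IJk; rewrite [X in (X <= _)%N -> _](_ : _ = #|I :&: J|).
    move=> /leq_trans; apply; apply: rk_mono; apply/bigcupsP => i.
    rewrite !inE => /and3P[/negbTE ik iI iJ]; rewrite subsetI.
    by apply/andP; split; apply: (bigcup_max i) => //; rewrite /del ik.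
  by rewrite [RHS](cardsD1 k) inE kI kJ.
have IJ0 : I :|: J != set0 by apply/set0Pn; exists k; rewrite inE kI.
have := hS _ IJ0.
have /(rk_mono M) : \bigcup_(i in I :|: J) S i \subset
    (\bigcup_(i in I) del s i) :|: (\bigcup_(i in J) del s' i).
  apply/bigcupsP => i; have [-> _|ik] := eqVneq i k.
    apply/subsetP => t tk; rewrite inE; have [->|ts] := eqVneq t s.
      by apply/orP; right; apply/bigcupP; exists k; rewrite // /del eqxx !inE ss'.
    by apply/orP; left; apply/bigcupP; exists k; rewrite // /del eqxx !inE ts.
  rewrite inE => /orP[iI|iJ]; apply/subsetU/orP; [left|right];
  by apply: (bigcup_max i) => //; rewrite /del (negbTE ik).
have := cardsUI I J; lia.
Qed.

End Shrink.

(** * Splitting pairs by flats *)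

Section Split.
Variables (E : finType) (M : matroid E) (I : finType) (a b : I -> E).
Implicit Types (F G H : {set E}) (K J : {set I}).

Definition ends K : {set E} := \bigcup_(k in K) [set a k; b k].

Definition splits F k : bool := (a k \in F) != (b k \in F).

Lemma endsU K J : ends (K :|: J) = ends K :|: ends J.
Proof. exact: bigcup_setU. Qed.

Lemma ends1 k : ends [set k] = [set a k; b k].
Proof. by rewrite /ends big_set1. Qed.

(** The dragon-Hall-Rado condition of the pairs of [K] in the contraction by
    [F]. *)
Definition relative_dragon F K : Prop :=
  forall J, J \subset K -> J != set0 ->
    (rk M F + #|J|.+1 <= rk M (F :|: ends J))%N.

(** An end inside [F] would be a loop of the contraction, and the pair would
    have rank at most [1] there. *)
Lemma relative_dragon_notin F K k :
  relative_dragon F K -> k \in K -> (a k \notin F) /\ (b k \notin F).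
Proof.
move=> hK kK; have := hK [set k]; rewrite sub1set kK ends1 cards1 => /(_ isT).
have k0 : [set k] != set0 by apply/set0Pn; exists k; rewrite inE.
have add1 x y : x \in F -> (rk M (F :|: [set x; y]) <= (rk M F).+1)%N.
  move=> xF; rewrite setUA [F :|: [set x]](setUidPl _) ?sub1set // setUC.
  exact: rk_setU1.
move=> /(_ k0) rk2; split; apply/negP => xF; last first.
  by have := add1 _ (a k) xF; rewrite (setUC [set b k]); lia.
by have := add1 _ (b k) xF; lia.
Qed.

Lemma relative_dragon_sub F K J :
  J \subset K -> relative_dragon F K -> relative_dragon F J.
Proof. by move=> sJ hK L sL; apply/hK/(subset_trans sL). Qed.

(** Let [J] be maximal without [k] such that [F], the pairs of [J] and the
    single element [a k] have together rank [#|J|+1] over [F], the least value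
    that the condition permits; the empty set is such a [J].  Take for [H] the
    flat they span.  If [b k] were in [H], then [k |: J] would violate the
    condition.  For a nonempty set [L] of the remaining pairs, maximality of [J]
    makes the rank of [J :|: L] together with [a k] exceed the least permitted
    value by one, and this one is what the condition for [L] over [H] needs. *)
Lemma split_flat F G K k :
  F \subset G -> flat M G -> ends K \subset G -> relative_dragon F K -> k \in K ->
  exists H J, [/\ flat M H, F \subset H, H \subset G, J \subset K :\ k & ends J \subset H]
    /\ [/\ a k \in H, b k \notin H & relative_dragon H ((K :\ k) :\: J)].
Proof.
move=> sFG fG sKG hK kK.
have [aF _] := relative_dragon_notin hK kK.
pose Y J := F :|: ends J :|: [set a k].
pose tight J := (J \subset K :\ k) && (rk M (Y J) == rk M F + #|J|.+1)%N.
have rk2 : (rk M F + 2 <= rk M (F :|: [set a k; b k]))%N.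
  have := hK [set k]; rewrite sub1set kK ends1 cards1; apply=> //.
  by apply/set0Pn; exists k; rewrite inE.
have tight0 : tight set0.
  rewrite /tight sub0set cards0 /Y /ends big_set0 setU0 setUC.
  have := rk_setU1 M F (a k).
  have := rk_setU1 M (a k |: F) (b k).
  have -> : b k |: (a k |: F) = F :|: [set a k; b k] by rewrite setUCA setUA setUC.
  by lia.
have [J /maxsetP[/andP[sJ /eqP rkJ] maxJ] _] := maxset_exists tight0.
pose H := flat_hull M (Y J).
have sYH : Y J \subset H := sub_flat_hull M (Y J).
have rkH : rk M H = (rk M F + #|J|.+1)%N by rewrite /H rk_flat_hull.
have rkHU A : rk M (H :|: A) = rk M (Y J :|: A) by apply: rk_flat_hullU.
have fH : flat M H by apply: flat_hull_flat.
have sYG : Y J \subset G.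
  rewrite !subUset sFG sub1set (subsetP sKG) ?andbT; last first.
    by apply/bigcupP; exists k; rewrite // !inE eqxx.
  apply: subset_trans sKG; apply/bigcupsP => j jJ.
  by apply: (bigcup_max j) => //; have := subsetP sJ j jJ; rewrite inE => /andP[].
have aH : a k \in H by apply: (subsetP sYH); rewrite !inE eqxx orbT.
have sHG : H \subset G by apply: flat_hull_sub.
clearbody H; exists H, J; split; split=> //.
- by apply: subset_trans sYH; rewrite /Y -setUA subsetUl.
- by apply: subset_trans sYH; rewrite /Y setUAC subsetUr.
- apply/negP => bH.
  have sJK : k |: J \subset K.
    by rewrite subUset sub1set kK (subset_trans sJ) ?subD1set.
  have kJ0 : k |: J != set0 by apply/set0Pn; exists k; rewrite !inE eqxx.
  have kJ : k \notin J by apply/negP => /(subsetP sJ); rewrite !inE eqxx.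
  have := hK _ sJK kJ0; rewrite cardsU1 kJ add1n.
  have /(rk_mono M) : F :|: ends (k |: J) \subset H.
    move: sYH; rewrite endsU ends1 !subUset !sub1set bH.
    by move=> /andP[/andP[-> ->] ->].
  by move=> leH /leq_trans/(_ leH); rewrite rkH leq_add2l ltnn.
- move=> L sL L0.
  have [sLK dLJ] : L \subset K :\ k /\ [disjoint L & J].
    by move: sL; rewrite subsetD => /andP[].
  rewrite rkHU rkH.
  have cJL : #|J :|: L| = (#|J| + #|L|)%N.
    by rewrite cardsU setIC (disjoint_setI0 dLJ) cards0 subn0.
  have sJL : J :|: L \subset K :\ k by rewrite subUset sJ.
  have JL0 : J :|: L != set0.
    by apply: contraNneq L0 => JL; rewrite -subset0 -JL subsetUr.
  have := hK _ (subset_trans sJL (subD1set _ _)) JL0.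
  have eY : Y (J :|: L) = Y J :|: ends L.
    by rewrite /Y endsU setUA setUAC.
  have leY : (rk M (F :|: ends (J :|: L)) <= rk M (Y (J :|: L)))%N.
    by apply: rk_mono; apply: subsetUl.
  have neqY : rk M (Y (J :|: L)) != (rk M F + #|J :|: L|.+1)%N.
    apply/negP => rkJL; have eJ : J :|: L = J.
      by apply: maxJ; rewrite ?subsetUl // /tight sJL rkJL.
    move: cJL; rewrite eJ -{1}[#|J|]addn0 => /addnI /esym /eqP.
    by rewrite cards_eq0 (negbTE L0).
  by move=> /leq_trans/(_ leY); rewrite leq_eqVlt eq_sym (negbTE neqY) /= cJL eY -addnA addSn !addnS.
Qed.

(** An item [(k, H)] stands for the factor of index [k] with the flat [H] chosen
    from its expansion; [p] comes before [q].  A flat that separates a later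
    pair would annihilate the later factor, since for a member [F] of the chain
    with [x] in [F] and [y] outside, one can expand the factor of [{x, y}] over
    flats that contain [y] and not [x], all incomparable to [F]. *)
Definition elimination_step (p q : I * {set E}) : bool :=
  nested p.2 q.2 && ~~ splits p.2 q.1.

(** Split by a flat [H] that separates the pair [k], then recurse between [F] and
    [H] and between [H] and [G].  The pairs of the upper part have no end in [H],
    so no flat of the lower part separates them; the flats of the upper part
    contain [H], but they come last, after the pairs inside [H]. *)
Lemma elimination_order F G K :
  F \subset G -> flat M G -> ends K \subset G -> relative_dragon F K ->
  exists s : seq (I * {set E}),
    [/\ uniq (map fst s), map fst s =i K, pairwise elimination_step s
      & forall p, p \in s ->
          [&& flat M p.2, F \proper p.2, p.2 \proper G & splits p.2 p.1]].
Proof.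
have [m] := ubnP #|K|; elim: m F G K => // m IHm F G K leKm sFG fG sKG hK.
have [K0|[k kK]] := set_0Vmem K.
  by exists [::]; split=> // p; rewrite K0 inE.
have [H [J [[fH sFH sHG sJ sJH] [aH bH hL]]]] := split_flat sFG fG sKG hK kK.
have [aF _] := relative_dragon_notin hK kK.
set L := (K :\ k) :\: J in hL.
have sJK : J \subset K := subset_trans sJ (subD1set _ _).
have sLK : L \subset K by rewrite (subset_trans (subsetDl _ _)) ?subD1set.
have ltK (A : {set I}) : A \subset K :\ k -> (#|A| < m)%N.
  move=> sA; apply: leq_ltn_trans (subset_leq_card sA) _.
  by move: leKm; rewrite (cardsD1 k K) kK add1n ltnS.
have sLG : ends L \subset G.
  by apply: subset_trans sKG; apply/bigcupsP => j /(subsetP sLK) jK; apply: (bigcup_max j).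
have [s [us sJs ps hs]] := IHm _ _ _ (ltK _ sJ) sFH fH sJH (relative_dragon_sub sJK hK).
have [t [ut tLt pt ht]] := IHm _ _ _ (ltK _ (subsetDl _ _)) sHG fG sLG hL.
have notinH q : q \in t -> (a q.1 \notin H) /\ (b q.1 \notin H).
  by move=> qt; apply: relative_dragon_notin hL _; rewrite -tLt map_f.
have inH q : q \in s -> (a q.1 \in H) /\ (b q.1 \in H).
  move=> qs; have qJ : q.1 \in J by rewrite -sJs map_f.
  by split; apply: (subsetP sJH); apply/bigcupP; exists q.1; rewrite // !inE eqxx ?orbT.
exists ((k, H) :: s ++ t); split.
- rewrite /= map_cat mem_cat sJs tLt cat_uniq us ut andbT /=.
  have /negbTE -> : k \notin J by apply/negP => /(subsetP sJ); rewrite !inE eqxx.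
  by rewrite !inE eqxx andbF /=; apply/hasPn => j; rewrite tLt /= sJs inE => /andP[].
- move=> j; rewrite /= map_cat inE mem_cat sJs tLt !inE.
  have := subsetP sJ j; rewrite !inE; case: eqP => [->|_] //=.
  by case: (j \in J) => // /(_ isT) ->.
- rewrite pairwise_cons pairwise_cat ps pt !andbT; apply/andP; split.
    rewrite all_cat; apply/andP; split; apply/allP => q qst.
      have [aqH bqH] := inH q qst.
      have /and4P[_ _ /proper_sub sqH _] := hs q qst.
      by rewrite /elimination_step /nested sqH orbT /splits /= aqH bqH.
    have [/negbTE aqH /negbTE bqH] := notinH q qst.
    have /and4P[_ /proper_sub sHq _ _] := ht q qst.
    by rewrite /elimination_step /nested sHq /splits /= aqH bqH.
  apply/allrelP => p q ps' qt.
  have [aqH bqH] := notinH q qt.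
  have /and4P[_ /proper_sub sHq _ _] := ht q qt.
  have /and4P[_ _ /proper_sub spH _] := hs p ps'.
  rewrite /elimination_step /nested (subset_trans spH sHq) /splits /=.
  have /negbTE -> : a q.1 \notin p.2 by apply: contraNN aqH => /(subsetP spH).
  by have /negbTE -> : b q.1 \notin p.2 by apply: contraNN bqH => /(subsetP spH).
- move=> p; rewrite inE mem_cat => /or3P[/eqP ->|/hs|/ht] /=.
  + rewrite fH /splits aH (negbTE bH) /= andbT; apply/andP; split; apply/properP; split=> //.
      by exists (a k).
    exists (b k) => //; apply: (subsetP sKG); apply/bigcupP; exists k => //.
    by rewrite !inE eqxx orbT.
  + by case/and4P=> -> -> /proper_sub_trans -> // ->.
  + by case/and4P=> -> /(sub_proper_trans sFH) -> -> ->.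
Qed.

End Split.

(** * Grading and monomials of the Chow ring *)

Section Grading.
Variables (E : finType) (M : matroid E).

Local Notation pflat := {F : {set E} | proper_flat M F}.

Lemma chow_gr1 : chow_gr 0 (1 : chow M).
Proof. by exists 1; split; [apply: dhomog1 | rewrite /chow_pi rmorph1]. Qed.

Lemma chow_gr_x (F : pflat) : chow_gr 1 (x_ F).
Proof. by exists (var F); split; rewrite // /var dhomogX /= mdeg1. Qed.

Lemma chow_grM m n (u v : chow M) :
  chow_gr m u -> chow_gr n v -> chow_gr (m + n) (u * v).
Proof.
move=> [p [hp ->]] [q [hq ->]]; exists (p * q); split; first exact: dhomogM.
by rewrite /chow_pi rmorphM.
Qed.

Lemma chow_grD n (u v : chow M) : chow_gr n u -> chow_gr n v -> chow_gr n (u + v).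
Proof.
move=> [p [hp ->]] [q [hq ->]]; exists (p + q); split; first exact: dhomogD.
by rewrite /chow_pi rmorphD.
Qed.

Lemma chow_gr0 n : chow_gr n (0 : chow M).
Proof. by exists 0; split; [apply: dhomog0 | rewrite /chow_pi rmorph0]. Qed.

Lemma chow_gr_sum n (T : finType) (P : pred T) (u : T -> chow M) :
  (forall t, P t -> chow_gr n (u t)) -> chow_gr n (\sum_(t | P t) u t).
Proof.
by move=> hu; apply: (big_ind (chow_gr n)) => //; [apply: chow_gr0 | apply: chow_grD].
Qed.

Lemma chow_gr_prod (T : eqType) (s : seq T) (u : T -> chow M) :
  {in s, forall t, chow_gr 1 (u t)} -> chow_gr (size s) (\prod_(t <- s) u t).
Proof.
elim: s => [|t s IHs] hu; first by rewrite big_nil; apply: chow_gr1.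
rewrite big_cons /= -add1n; apply: chow_grM; first by apply: hu; rewrite inE eqxx.
by apply: IHs => v vs; apply: hu; rewrite inE vs orbT.
Qed.

Lemma x_incomparable (F G : pflat) : ~~ nested (val F) (val G) -> x_ F * x_ G = 0.
Proof.
rewrite negb_or => /andP[nFG nGF]; rewrite /x_ /chow_pi -rmorphM -(rmorph0 \pi_(chow M)).
apply/eqP; rewrite -Quotient.idealrBE subr0; apply/asboolP.
exists [:: (1, var F * var G)]; split; last by rewrite big_seq1 mul1r.
by move=> cg; rewrite inE => /eqP ->; apply: Rel_incomparable.
Qed.

Definition chain (C : {set pflat}) : Prop :=
  {in C &, forall F G, nested (val F) (val G)}.

Definition monomial (C : {set pflat}) : chow M := \prod_(F in C) x_ F.

Lemma chainU1 (C : {set pflat}) (F : pflat) :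
  chain C -> {in C, forall G, nested (val F) (val G)} -> chain (F |: C).
Proof.
move=> hC hF G H; rewrite !inE => /predU1P[->|GC] /predU1P[->|HC].
- exact: nested_refl.
- exact: hF.
- by rewrite nestedC; apply: hF.
- exact: hC.
Qed.

Lemma chow_gr_monomial (C : {set pflat}) : chow_gr #|C| (monomial C).
Proof.
by rewrite /monomial -big_enum cardE; apply: chow_gr_prod => F _; apply: chow_gr_x.
Qed.

Lemma monomialU1 (C : {set pflat}) F : F \notin C -> monomial (F |: C) = x_ F * monomial C.
Proof. exact: big_setU1. Qed.

Lemma monomial_incomparable (C : {set pflat}) F G :
  G \in C -> ~~ nested (val F) (val G) -> x_ F * monomial C = 0.
Proof.
by move=> GC nFG; rewrite /monomial (bigD1 G) //= mulrA x_incomparable ?mul0r.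
Qed.

End Grading.

(** * The degree of a complete flag *)

Section Degree.
Variables (E : finType) (M : matroid E) (deg : chow M -> int) (hdeg : degree_map deg).

Local Notation pflat := {F : {set E} | proper_flat M F}.
Local Notation top := (chow_gr (rank M).-1).

Lemma deg_sum (T : finType) (P : pred T) (u : T -> chow M) :
  (forall t, P t -> top (u t)) -> deg (\sum_(t | P t) u t) = \sum_(t | P t) deg (u t).
Proof.
move=> hu.
have deg0 : deg 0 = 0.
  have := degD hdeg (chow_gr0 M _) (chow_gr0 M _); rewrite addr0 => /eqP.
  by rewrite -subr_eq0 opprD addrA subrr sub0r oppr_eq0 => /eqP.
suff : top (\sum_(t | P t) u t) /\ deg (\sum_(t | P t) u t) = \sum_(t | P t) deg (u t).
  by case.
apply: (big_ind2 (fun v z => top v /\ deg v = z)) => [|v y w z [hv <-] [hw <-]|t /hu //].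
  by split=> //; apply: chow_gr0.
by split; [apply: chow_grD | apply: degD].
Qed.

(** Sorting by cardinality turns the chain [C] into a flag in increasing order,
    the form in which the degree is normalized. *)
Lemma deg_monomial (C : {set pflat}) :
  chain C -> #|C| = (rank M).-1 -> deg (monomial C) = 1.
Proof.
move=> hC cC; have [F0|[F0 _]] := set_0Vmem C.
  (* The rank is at most 1, and the flag is indexed by an empty type. *)
  have no_ord (i : 'I_(rank M).-1) : False.
    by case: i => i; rewrite -cC F0 cards0.
  rewrite -(deg_flag hdeg (F := fun i => False_rect _ (no_ord i))); last first.
    by move=> i; case: (no_ord i).
  by rewrite /monomial F0 big_set0 big1 // => i; case: (no_ord i).
pose le (F G : pflat) := (#|val F| <= #|val G|)%N.
pose s := sort le (enum C).
have ss : size s = (rank M).-1 by rewrite size_sort -cardE.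
have us : uniq s by rewrite sort_uniq enum_uniq.
have ms F : (F \in s) = (F \in C) by rewrite mem_sort mem_enum.
have sorts : sorted le s by apply: sort_sorted => F G; apply: leq_total.
rewrite -(deg_flag hdeg (F := fun i => nth F0 s i)).
  congr (deg _); rewrite /monomial -big_enum (perm_big s) /=; last by rewrite perm_sym perm_sort.
  by rewrite (big_nth F0) ss big_mkord.
move=> i j ij; have [si sj] : (i < size s)%N /\ (j < size s)%N by rewrite ss.
have := sorted_leq_nth _ _ F0 sorts i j si sj.
have := hC (nth F0 s i) (nth F0 s j); rewrite -!ms !mem_nth // => /(_ isT isT).
have : nth F0 s i != nth F0 s j by rewrite nth_uniq // neq_ltn ij.
rewrite -(inj_eq val_inj) /nested properEneq => -> /orP[//|sji] h.
rewrite /= (eqP (_ : val (nth F0 s j) == val (nth F0 s i))) //.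
rewrite eqEcard sji /=; apply: h => //.
- by move=> x y z; apply: leq_trans.
- by move=> x; apply: leqnn.
- exact: ltnW.
Qed.

End Degree.

(** * Expansion of the classes alpha and beta along a chain *)

Section CutFamily.
Variables (E : finType) (M : matroid E).

Local Notation pflat := {F : {set E} | proper_flat M F}.

(** What [alpha_] and [beta_] have in common.  In the expansion, the terms may
    depend on a chain [C] by which the class is going to be multiplied: their
    traces on [S] differ from those of all members of [C], which excludes squares
    and keeps track of the distinct traces that the rank bound needs. *)
Record cut_family (gamma : {set E} -> chow M) : Prop := CutFamily {
  cut_expansion : forall (S : {set E}) (C : {set pflat}), S != set0 -> chain C ->
    exists P : {set pflat}, gamma S = \sum_(F in P) x_ F /\
      forall F, F \in P -> separates (val F) S /\
        forall G, G \in C -> S :&: val F != S :&: val G;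
  cut_mono : forall S S' : {set E}, S' \subset S ->
    exists P : {set pflat}, gamma S = gamma S' + \sum_(F in P) x_ F;
  cut_pair : forall a b,
    gamma [set a; b] = \sum_(F : pflat | (a \in val F) && (b \notin val F)) x_ F
}.

(** The least member of the chain that meets [S] provides [i].  For [beta_] this
    is applied to the chain itself, for [alpha_] to the complements of its
    members. *)
Lemma common_element (T : finType) (C : {set T}) (f : T -> {set E}) (S : {set E}) :
  S != set0 -> {in C &, forall F G, nested (f F) (f G)} ->
  exists2 i, i \in S & forall G, G \in C -> S :&: f G != set0 -> i \in f G.
Proof.
move=> /set0Pn[i0 i0S] hC.
have [G0 /andP[G0C G0S]|noC] :=
  pickP (fun G => (G \in C) && (S :&: f G != set0)).
  pose Q := [pred G | (G \in C) && (S :&: f G != set0)].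
  have G0P : Q G0 by rewrite /= G0C.
  have [G1 /andP[G1C /set0Pn[i iSG1]] minG] := @arg_minnP _ _ Q (fun G => #|f G|) G0P.
  have /setIP[iS iG1] := iSG1; exists i => // G GC GS.
  have /orP[/subsetP->//|sGG1] := hC _ _ G1C GC.
  by have /eqP-> : f G == f G1 by rewrite eqEcard sGG1 minG //= GC.
by exists i0 => // G GC GS; have := noC G; rewrite GC GS.
Qed.

Lemma alpha_sum (S : {set E}) i : i \in S ->
  alpha_ M S = \sum_(F : pflat | (i \in val F) && ~~ (S \subset val F)) x_ F.
Proof.
move=> iS; rewrite /alpha_ (alphaE M i).
rewrite (bigID (fun F : pflat => S \subset val F)) /= addrC.
rewrite [X in _ + X - _](eq_bigl (fun F : pflat => S \subset val F)) ?addrK // => F.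
by case sSF: (S \subset _); rewrite ?andbF // (subsetP sSF).
Qed.

Lemma beta_sum (S : {set E}) i : i \in S ->
  beta_ M S = \sum_(F : pflat | (i \notin val F) && (S :&: val F != set0)) x_ F.
Proof.
move=> iS; rewrite /beta_ (betaE M i).
rewrite (bigID (fun F : pflat => val F \subset ~: S)) /= addrC.
rewrite [X in _ + X - _](eq_bigl (fun F : pflat => val F \subset ~: S)) => [|F].
  rewrite addrK; apply: eq_bigl => F.
  by rewrite -disjoints_subset -setI_eq0 setIC.
by case sFS: (_ \subset _); rewrite ?andbF // andbT; apply/negP => /(subsetP sFS); rewrite inE iS.
Qed.

Lemma cut_family_alpha : cut_family (alpha_ M).
Proof.
split=> [S C S0 hC|S S' sS'S|a b].
- have [F G FC GC|i iS hi] := @common_element _ C (fun F => ~: val F) S S0.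
    by have := hC _ _ FC GC; rewrite /nested !setCS orbC.
  exists [set F : pflat | (i \in val F) && ~~ (S \subset val F)]; split.
    by rewrite (alpha_sum iS); apply: eq_bigl => F; rewrite inE.
  move=> F; rewrite inE => /andP[iF nSF]; split.
    rewrite /separates nSF andbT; apply/set0Pn.
    by exists i; rewrite inE iS.
  move=> G GC; apply: contraNneq nSF => eFG.
  have iG : i \in val G.
    by have /setP/(_ i) := eFG; rewrite !inE iS iF.
  have := hi G GC; rewrite !inE iG setI_eq0 -subsets_disjoint.
  by move=> h; apply/setIidPl; rewrite eFG; apply/setIidPl; apply: contraT => /h.
- exists [set F : pflat | (S' \subset val F) && ~~ (S \subset val F)].
  rewrite /alpha_ [in RHS](bigID (fun F : pflat => S \subset val F)) /=.
  rewrite [X in _ = _ - (X + _) + _](eq_bigl (fun F : pflat => S \subset val F)) => [|F].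
    by rewrite (eq_bigl _ _ (in_set _)) opprD addrA addrNK.
  by case sSF: (S \subset _); rewrite ?andbF // (subset_trans sS'S).
- rewrite (@alpha_sum _ a) ?inE ?eqxx //; apply: eq_bigl => F.
  by rewrite subUset !sub1set; case: (a \in _).
Qed.

Lemma cut_family_beta : cut_family (beta_ M).
Proof.
split=> [S C S0 hC|S S' sS'S|a b].
- have [i iS hi] := @common_element _ C (fun F => val F) S S0 hC.
  exists [set F : pflat | (i \notin val F) && (S :&: val F != set0)]; split.
    by rewrite (beta_sum iS); apply: eq_bigl => F; rewrite inE.
  move=> F; rewrite inE => /andP[iF SF]; split.
    by rewrite /separates SF; apply: contraNN iF => /subsetP->.
  move=> G GC; apply: contraNneq iF => eFG.
  have := hi G GC; rewrite -eFG => /(_ SF) iG.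
  by have /setP/(_ i) := eFG; rewrite !inE iS iG.
- exists [set F : pflat | (val F \subset ~: S') && ~~ (val F \subset ~: S)].
  rewrite /beta_ [in RHS](bigID (fun F : pflat => val F \subset ~: S)) /=.
  rewrite [X in _ = _ - (X + _) + _](eq_bigl (fun F : pflat => val F \subset ~: S)) => [|F].
    by rewrite (eq_bigl _ _ (in_set _)) opprD addrA addrNK.
  by case sSF: (_ \subset ~: S); rewrite ?andbF // (subset_trans sSF) ?setCS.
- rewrite (@beta_sum _ b) ?inE ?eqxx ?orbT //; apply: eq_bigl => F.
  rewrite andbC; case bF: (b \in val F); rewrite ?andbF // !andbT.
  apply/set0Pn/idP => [[x]|aF]; last by exists a; rewrite !inE eqxx.
  by rewrite !inE => /andP[/orP[/eqP->|/eqP->]]; rewrite ?bF.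
Qed.

End CutFamily.

(** * Positivity of products *)

Section CutDegree.
Variables (E : finType) (M : matroid E) (deg : chow M -> int) (hdeg : degree_map deg).
Variables (gamma : {set E} -> chow M) (hgamma : cut_family gamma).

Local Notation pflat := {F : {set E} | proper_flat M F}.
Local Notation r1 := (rank M).-1.
Implicit Types (C P : {set pflat}) (S : {set E}) (l : seq {set E}).

Lemma chain0 : chain (set0 : {set pflat}).
Proof. by move=> F G; rewrite inE. Qed.

Lemma chow_gr_cut S : S != set0 -> chow_gr 1 (gamma S).
Proof.
move=> S0; have [P [-> _]] := cut_expansion hgamma S0 chain0.
by apply: chow_gr_sum => F _; apply: chow_gr_x.
Qed.

Definition cut_prod l : chow M := \prod_(S <- l) gamma S.

Lemma chow_gr_cut_prod l : all (fun S => S != set0) l -> chow_gr (size l) (cut_prod l).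
Proof. by move=> /allP hl; apply: chow_gr_prod => S /hl /chow_gr_cut. Qed.

Lemma chow_gr_top l C :
  all (fun S => S != set0) l -> (size l + #|C| = r1)%N ->
  chow_gr r1 (cut_prod l * monomial C).
Proof.
by move=> hl <-; apply: chow_grM; [apply: chow_gr_cut_prod | apply: chow_gr_monomial].
Qed.

(** Flats incomparable to a member of [C] contribute zero, so only longer chains
    remain. *)
Lemma cut_step S C : S != set0 -> chain C ->
  exists P, gamma S * monomial C = \sum_(F in P) monomial (F |: C) /\
    forall F, F \in P -> [/\ F \notin C, {in C, forall G, nested (val F) (val G)},
      separates (val F) S & forall G, G \in C -> S :&: val F != S :&: val G].
Proof.
move=> S0 hC; have [P [-> hP]] := cut_expansion hgamma S0 hC.
pose ok (F : pflat) := [forall G in C, nested (val F) (val G)].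
have PC F : F \in P -> F \notin C.
  by move=> /hP[_ h]; apply/negP => /h; rewrite eqxx.
exists [set F in P | ok F]; split; last first.
  move=> F; rewrite inE => /andP[FP /forall_inP okF]; have [sepF neF] := hP F FP.
  by split=> //; apply: PC.
rewrite mulr_suml (bigID ok) /= [X in _ + X]big1 ?addr0 => [|F /andP[_]].
  by apply: eq_big => F; [rewrite inE | move=> /andP[/PC FC _]; rewrite monomialU1].
by rewrite negb_forall_in => /exists_inP[G GC]; apply: monomial_incomparable.
Qed.

Lemma deg_cut_step S l C P :
  S != set0 -> all (fun A => A != set0) l -> (size l + #|C| = r1.-1)%N -> (0 < r1)%N ->
  gamma S * monomial C = \sum_(F in P) monomial (F |: C) ->
  (forall F, F \in P -> F \notin C) ->
  deg (cut_prod (S :: l) * monomial C) = \sum_(F in P) deg (cut_prod l * monomial (F |: C)).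
Proof.
move=> S0 hl szC r1_gt0 eP PC.
rewrite /cut_prod big_cons mulrAC mulrC eP mulr_sumr.
apply: deg_sum => // F /PC FC; apply: chow_gr_top => //.
by rewrite cardsU1 FC addnCA szC add1n prednK.
Qed.

Lemma deg_cut_ge0 l C :
  all (fun S => S != set0) l -> chain C -> (size l + #|C| = r1)%N ->
  0 <= deg (cut_prod l * monomial C).
Proof.
elim: l C => [|S l IHl] C /=.
  by move=> _ hC szC; rewrite /cut_prod big_nil mul1r deg_monomial.
move=> /andP[S0 hl] hC szC; have [P [eP hP]] := cut_step S0 hC.
rewrite (deg_cut_step S0 hl _ _ eP) -?szC //; last by move=> F /hP[].
apply: sumr_ge0 => F /hP[FC nF _ _]; apply: IHl => //; first exact: chainU1.
by rewrite cardsU1 FC addnCA add1n -addSn.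
Qed.

(** A complete flag in the expansion is recorded as a choice of a flat [G k] for
    each factor.  The last clause is symmetric in [j] and [k], so that it does
    not depend on the order of multiplication: if [k] was multiplied later, then
    [G k] was chosen with a trace on [S k] different from that of [G j]. *)
Lemma deg_cut_flats (T : eqType) (S : T -> {set E}) (s : seq T) C :
  (forall k, S k != set0) -> uniq s -> chain C -> (size s + #|C| = r1)%N ->
  0 < deg (cut_prod (map S s) * monomial C) ->
  exists G : T -> {set E},
    [/\ {in s, forall k, flat M (G k) /\ separates (G k) (S k)},
        {in s &, forall j k, nested (G j) (G k)},
        {in s & C, forall k F, nested (G k) (val F) /\ S k :&: G k != S k :&: val F}
      & {in s &, forall j k, j != k ->
          S j :&: G j != S j :&: G k \/ S k :&: G j != S k :&: G k}].
Proof.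
move=> S0; elim: s C => [|k s IHs] C.
  by exists (fun=> set0).
move=> /= /andP[ks us] hC szC; have [P [eP hP]] := cut_step (S0 k) hC.
have hl : all (fun A => A != set0) (map S s) by apply/allP => _ /mapP[j _ ->].
rewrite (deg_cut_step (S0 k) hl _ _ eP) -?szC ?size_map //; last by move=> F /hP[].
have [F /andP[FP Fpos]|noF] := 
  pickP (fun F => (F \in P) && (0 < deg (cut_prod (map S s) * monomial (F |: C)))); last first.
  rewrite ltNge sumr_le0 // => F FP; rewrite leNgt; apply/negP => h.
  by have := noF F; rewrite FP h.
have [FC nF sepF neF] := hP F FP.
have [|G [sG nG CG tG]] := IHs (F |: C) us (chainU1 hC nF) _ Fpos.
  by rewrite cardsU1 FC addnCA add1n -addSn.
pose G' j := if j == k then val F else G j.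
have G'k : G' k = val F by rewrite /G' eqxx.
have G's j : j \in s -> G' j = G j.
  by move=> js; rewrite /G'; case: eqP js ks => // -> ->.
have FFC : F \in F |: C by rewrite !inE eqxx.
exists G'; split.
- move=> j; rewrite inE => /predU1P[->|/[dup] js /G's->]; last exact: sG.
  by rewrite G'k; split=> //; have /and3P[] := valP F.
- move=> i j; rewrite !inE => /predU1P[->|/[dup] is_ /G's->] /predU1P[->|/[dup] js /G's->]; rewrite ?G'k.
  + exact: nested_refl.
  + by rewrite nestedC; have [] := CG j F js FFC.
  + by have [] := CG i F is_ FFC.
  + exact: nG.
- move=> j L; rewrite inE => /predU1P[->|/[dup] js /G's->] LC; rewrite ?G'k.
    by split; [apply: nF | apply: neF].
  by apply: CG => //; rewrite inE LC orbT.
- move=> i j; rewrite !inE => /predU1P[->|/[dup] is_ /G's->] /predU1P[->|/[dup] js /G's->]; rewrite ?G'k ?eqxx //.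
  + by move=> _; right; rewrite eq_sym; have [] := CG j F js FFC.
  + by move=> _; left; have [] := CG i F is_ FFC.
  + exact: tG.
Qed.

(** Two flats of the flag with distinct traces on some [S k] have distinct traces
    on the union [T], hence traces of distinct rank; the ranks are positive and
    less than [rk T] as each flat separates [T]. *)
Lemma dragon_of_deg_gt0 (S : 'I_r1 -> {set E}) :
  loopless M -> (forall k, S k != set0) ->
  0 < deg (\prod_(k < r1) gamma (S k)) -> dragon_Hall_Rado M S.
Proof.
move=> hM S0 pos.
have sz : (size (enum 'I_r1) + #|set0 : {set pflat}| = r1)%N.
  by rewrite cards0 addn0 size_enum_ord.
have pos0 : 0 < deg (cut_prod (map S (enum 'I_r1)) * monomial (set0 : {set pflat})).
  by rewrite /monomial big_set0 mulr1 /cut_prod big_map big_enum.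
have [G [sG nG _ tG]] := deg_cut_flats S0 (enum_uniq _) chain0 sz pos0.
move=> I I0; set T := \bigcup_(i in I) S i.
have sST k : k \in I -> S k \subset T by move=> kI; apply: (bigcup_max k).
pose f k := rk M (G k :&: T).
have f_inj : {in I &, injective f}.
  have f_neq j k : j \in I -> k \in I -> j != k -> G j \subset G k -> f j != f k.
    move=> jI kI jk sjk; have [fj _] := sG j (mem_enum _ _).
    rewrite neq_ltn trace_rk_lt // properEneq setSI // andbT.
    have [] := tG j k (mem_enum _ _) (mem_enum _ _) jk; apply: contraNneq => e.
      by rewrite -(setIidPl (sST j jI)) -!setIA ![T :&: _]setIC e.
    by rewrite -(setIidPl (sST k kI)) -!setIA ![T :&: _]setIC e.
  move=> j k jI kI fjk; apply/eqP/contraT => jk.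
  have /orP[s1|s1] := nG j k (mem_enum _ _) (mem_enum _ _).
    by have := f_neq _ _ jI kI jk s1; rewrite fjk eqxx.
  by rewrite eq_sym in jk; have := f_neq _ _ kI jI jk s1; rewrite fjk eqxx.
have f_bnd k : k \in I -> (0 < f k < rk M T)%N.
  move=> kI; have [fk /andP[/set0Pn[e /setIP[eS eG]] /subsetPn[e' e'S e'G]]] := sG k (mem_enum _ _).
  have eT := subsetP (sST k kI) e eS; have e'T := subsetP (sST k kI) e' e'S.
  apply/andP; split.
    by rewrite -(hM e) rk_mono // sub1set inE eG.
  have := @trace_rk_lt _ M (G k) setT T fk; rewrite setTI; apply.
  by apply/properP; split; [apply: subsetIr | exists e' => //; rewrite inE (negbTE e'G)].
have uf : uniq [seq f k | k <- enum I].
  by rewrite map_inj_in_uniq ?enum_uniq // => j k; rewrite !mem_enum; apply: f_inj.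
have sf : {subset [seq f k | k <- enum I] <= iota 1 (rk M T).-1}.
  move=> x /mapP[k]; rewrite mem_enum => /f_bnd /andP[f0 fT] ->.
  by rewrite mem_iota f0 add1n prednK // (leq_ltn_trans _ fT).
have := uniq_leq_size uf sf; rewrite size_map -cardE size_iota.
have [k kI] := set0Pn _ I0; have /andP[_ fT] := f_bnd k kI.
by rewrite add1n; case: (rk M T) fT.
Qed.

(** In the expansion of the first factor all terms have nonnegative degree once
    multiplied by the other factors, and the prescribed flat is among them, with
    positive degree by induction. *)
Lemma deg_elimination_gt0 (I : finType) (a b : I -> E) (s : seq (I * {set E})) C :
  {in s, forall p, proper_flat M p.2 && splits a b p.2 p.1} ->
  pairwise (elimination_step a b) s -> chain C -> (size s + #|C| = r1)%N ->
  {in s & C, forall p F, nested p.2 (val F) && ~~ splits a b (val F) p.1} ->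
  0 < deg (cut_prod [seq [set a p.1; b p.1] | p <- s] * monomial C).
Proof.
have pair0 x y : [set x; y] != set0 :> {set E}.
  by apply/set0Pn; exists x; rewrite !inE eqxx.
elim: s C => [|p s IHs] C hs ps hC szC hsC.
  by rewrite /cut_prod big_nil mul1r deg_monomial.
have /andP[pfp splp] := hs p (mem_head _ _).
pose Fp : pflat := exist _ p.2 pfp.
(* The expansion of the class of a pair is oriented; name the ends so that the
   prescribed flat occurs in it. *)
have [x [y [xp yp exy splE]]] : exists x y, [/\ x \in p.2, y \notin p.2,
    [set a p.1; b p.1] = [set x; y]
    & forall F, splits a b F p.1 = ((x \in F) != (y \in F))].
  move: splp; rewrite /splits; case ap: (a p.1 \in p.2); case bp: (b p.1 \in p.2) => // _.
    by exists (a p.1), (b p.1); rewrite ap bp.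
  exists (b p.1), (a p.1); rewrite ap bp; split=> // [|F]; first by rewrite setUC.
  by rewrite eq_sym.
pose ok (F : pflat) := [forall G in C, nested (val F) (val G)].
pose P : {set pflat} := [set F : pflat | [&& x \in val F, y \notin val F & ok F]].
have FpP : Fp \in P.
  rewrite inE /= xp yp; apply/forall_inP => G GC.
  by have /andP[] := hsC p G (mem_head _ _) GC.
have PC F : F \in P -> F \notin C.
  rewrite inE => /and3P[xF yF _]; apply/negP => FC.
  have /andP[_] := hsC p F (mem_head _ _) FC.
  by rewrite splE xF (negbTE yF).
have nP F : F \in P -> {in C, forall G, nested (val F) (val G)}.
  by rewrite inE => /and3P[_ _ /forall_inP].
have eP : gamma [set a p.1; b p.1] * monomial C = \sum_(F in P) monomial (F |: C).
  rewrite exy (cut_pair hgamma) mulr_suml (bigID ok) /= [X in _ + X]big1 ?addr0 => [|F /andP[_]].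
    by apply: eq_big => F; rewrite ?inE -?andbA // => FP; rewrite monomialU1 // PC // inE.
  by rewrite negb_forall_in => /exists_inP[G GC]; apply: monomial_incomparable.
have hl : all (fun A : {set E} => A != set0) [seq [set a q.1; b q.1] | q <- s].
  by apply/allP => _ /mapP[q _ ->].
have sz' F : F \in P -> (size s + #|F |: C| = r1)%N.
  by move=> /PC FC; rewrite cardsU1 FC addnCA add1n -addSn.
rewrite map_cons (deg_cut_step (pair0 _ _) hl _ _ eP PC) -?szC ?size_map //.
rewrite (bigD1 Fp) //=; apply: ltr_wpDr.
  apply: sumr_ge0 => F /andP[FP _]; apply: deg_cut_ge0; rewrite ?size_map ?sz' //.
  exact: chainU1 hC (nP F FP).
move: ps; rewrite pairwise_cons => /andP[/allP pps ps].
apply: IHs => // [q qs|||q F qs].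
- by apply: hs; rewrite inE qs orbT.
- exact: chainU1 hC (nP _ FpP).
- exact: sz'.
- move=> /setU1P[->|FC]; last by apply: hsC; rewrite ?inE ?qs ?orbT.
  by have := pps q qs; rewrite /elimination_step nestedC.
Qed.

(** Shrinking one factor removes a sum of variables [x_F] from it, and the
    product of [x_F] with the other factors has nonnegative degree.  The list [l]
    holds the factors already treated. *)
Lemma deg_cut_mono (T : Type) (S S' : T -> {set E}) (s : seq T) l :
  (forall k, S' k != set0) -> (forall k, S' k \subset S k) ->
  all (fun A => A != set0) l -> (size l + size s = r1)%N ->
  deg (cut_prod (l ++ map S' s)) <= deg (cut_prod (l ++ map S s)).
Proof.
move=> S'0 sS; have S0 k : S k != set0.
  by have /set0Pn[e /(subsetP (sS k)) eS] := S'0 k; apply/set0Pn; exists e.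
elim: s l => [|k s IHs] l hl szl; first by rewrite !cats0.
have := IHs (rcons l (S k)); rewrite !cat_rcons all_rcons S0 hl size_rcons addSnnS.
move=> /(_ isT szl); apply: le_trans.
have hls : all (fun A => A != set0) (l ++ map S' s).
  by rewrite all_cat hl; elim: (s) => //= j t ->; rewrite S'0.
have szls : (size (l ++ map S' s)).+1 = r1 by rewrite size_cat size_map -addnS.
have swap A : cut_prod (l ++ A :: map S' s) = gamma A * cut_prod (l ++ map S' s).
  by rewrite /cut_prod !big_cat big_cons /= mulrCA.
have [P eP] := cut_mono hgamma (sS k).
have grx F : chow_gr r1 (x_ F * cut_prod (l ++ map S' s)).
  by rewrite -szls -add1n; apply: chow_grM; [apply: chow_gr_x | apply: chow_gr_cut_prod].
rewrite /= !swap eP mulrDl mulr_suml (degD hdeg) ?lerDl.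
- rewrite deg_sum //; apply: sumr_ge0 => F _.
  have := @deg_cut_ge0 (l ++ map S' s) [set F] hls.
  rewrite /monomial big_set1 mulrC cards1 addn1; apply=> //.
  by move=> G H; rewrite !inE => /eqP-> /eqP->; apply: nested_refl.
- by rewrite -szls -add1n; apply: chow_grM; [apply: chow_gr_cut | apply: chow_gr_cut_prod].
- exact: chow_gr_sum.
Qed.

Lemma deg_gt0_of_dragon (S : 'I_r1 -> {set E}) :
  loopless M -> dragon_Hall_Rado M S -> 0 < deg (\prod_(k < r1) gamma (S k)).
Proof.
move=> hM hS; have [S' [sS' S'2 hS']] := dragon_shrink hM hS.
have S'0 k : S' k != set0 by rewrite -card_gt0 S'2.
have [a /fin_all_exists[b ab]] : exists a, forall k, exists b, S' k = [set a k; b].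
  apply: (@fin_all_exists _ _ (fun k x => exists y, S' k = [set x; y])) => k.
  by have /eqP/cards2P[x [y [_ e]]] := S'2 k; exists x, y.
have hrel : relative_dragon M a b set0 [set: 'I_r1].
  move=> J _ J0; have := hS' J J0; rewrite rk0 add0n add1n set0U /ends.
  by rewrite (eq_bigr (fun k => [set a k; b k])).
have fT : flat M [set: E] by apply/forallP => e; rewrite inE.
have [s [us sI ps hs]] := elimination_order (sub0set _) fT (subsetT _) hrel.
have perm_s : perm_eq (map fst s) (enum 'I_r1).
  by apply: uniq_perm; rewrite ?enum_uniq // => k; rewrite sI mem_enum inE.
have szs : size s = r1 by rewrite -(size_map fst) (perm_size perm_s) size_enum_ord.
have := deg_cut_mono S'0 sS' (l := [::]) (s := map fst s) isT.
rewrite size_map /cut_prod !cat0s !big_map -(big_enum _ _ _ (fun k => gamma (S k))).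
rewrite -(perm_big _ perm_s) big_map.
move=> /(_ szs); apply: lt_le_trans.
have -> : \prod_(p <- s) gamma (S' p.1) =
    cut_prod [seq [set a p.1; b p.1] | p <- s] * monomial (set0 : {set pflat}).
  by rewrite /monomial big_set0 mulr1 /cut_prod big_map; apply: eq_bigr => p _; rewrite ab.
apply: deg_elimination_gt0 => //.
- move=> p /hs /and4P[fp p0 pT spl]; rewrite /proper_flat fp spl andbT /=.
  by move: p0 pT; rewrite !properEneq eq_sym => /andP[-> _] /andP[->].
- exact: chain0.
- by rewrite cards0 addn0.
- by move=> p F _; rewrite inE.
Qed.

Lemma deg_gt0_dragon (S : 'I_r1 -> {set E}) :
  loopless M -> (forall k, S k != set0) ->
  0 < deg (\prod_(k < r1) gamma (S k)) <-> dragon_Hall_Rado M S.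
Proof. by move=> hM S0; split; [apply: dragon_of_deg_gt0 | apply: deg_gt0_of_dragon]. Qed.

End CutDegree.

Theorem theorem6p13 (E : finType) (M : matroid E) (hM : loopless M)
    (deg : chow M -> int) (hdeg : degree_map deg)
    (S : 'I_(rank M).-1 -> {set E}) (hS : forall k, S k != set0) :
  (0 < deg (\prod_(k < (rank M).-1) beta_ M (S k))
     <-> 0 < deg (\prod_(k < (rank M).-1) alpha_ M (S k)))
  /\
  (0 < deg (\prod_(k < (rank M).-1) beta_ M (S k))
     <-> dragon_Hall_Rado M S).
Proof.
have hb := deg_gt0_dragon hdeg (cut_family_beta M) hM hS.
have ha := deg_gt0_dragon hdeg (cut_family_alpha M) hM hS.
by split=> //; apply: iff_trans hb (iff_sym ha).
Qed.
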